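(* Let $G$ be a discrete finitely generated group such that all its subgroups are also finitely generated. Then $\mathrm{Sub}^c_G$ is closed in $\mathrm{Sub}_G$.
   Context: $\mathrm{Sub}_G$ is the compact space of all closed subgroups of $G$ with the Chabauty topology: a sub-basis is given by the sets $\{A\in\mathrm{Sub}_G\mid A\cap K=\emptyset\}$ ($K\subset G$ compact) and $\{A\in\mathrm{Sub}_G\mid A\cap U\ne\emptyset\}$ ($U\subset G$ open). $\mathrm{Sub}^c_G$ is the set of all closed cyclic subgroups of $G$ (for discrete $G$, all cyclic subgroups). *)

(* Defs.v *)
From HB Require Import structures.
From mathcomp Require Import all_boot all_classical topology.

Set Implicit Arguments.
Unset Strict Implicit.
Unset Printing Implicit Defensive.

Local Open Scope classical_set_scope.
Local Open Scope group_scope.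

HB.mixin Record isTopologicalGroup G of Group G & Topological G := {
  mulg_continuous : continuous (fun x : G * G => x.1 * x.2) ;
  invg_continuous : continuous (fun x : G => x^-1)
}.

#[short(type="topologicalGroupType")]
HB.structure Definition TopologicalGroup :=
  {G of Group G & Topological G & isTopologicalGroup G}.

#[short(type="discreteGroupType")]
HB.structure Definition DiscreteGroup :=
  {G of TopologicalGroup G & DiscreteTopology G}.

(* Every abstract group, with the discrete topology, is a discreteGroupType. *)
Section DiscreteTopologyGroup.
Variable G : groupType.
Local Notation D := (discrete_topology G).

HB.instance Definition _ := Group.copy D G.

Let mul_cont : continuous (fun x : D * D => x.1 * x.2).
Proof.
move=> x A /nbhs_singleton Ax.
exists ([set x.1], [set x.2]); first by split; exact: discrete_set1.
by case=> a b [/= -> ->].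
Qed.

Let inv_cont : continuous (fun x : D => x^-1).
Proof.
by move=> x A /nbhs_singleton Ax; rewrite nbhs_principalE;
  exact/principal_filterP.
Qed.

HB.instance Definition _ := isTopologicalGroup.Build D mul_cont inv_cont.
End DiscreteTopologyGroup.

Section Subgroups.
Variable G : groupType.
Implicit Types (A S : set G).

Definition subgroup A : Prop := group_closed [in A].

Definition generated S : set G := smallest subgroup S.

Definition finitely_generated A : Prop :=
  exists2 S, finite_set S & A = generated S.

Definition cyclic_subgroup A : Prop := exists g, A = generated [set g].

End Subgroups.

Definition closedSubgroup (G : topologicalGroupType) : Type :=
  set_type [set A : set G | subgroup A /\ closed A].

HB.instance Definition _ (G : topologicalGroupType) :=
  Choice.on (closedSubgroup G).

Section Chabauty.
Variable G : topologicalGroupType.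

Definition carrier (A : closedSubgroup G) : set G := val A.

Definition chabauty_subbase : set (set (closedSubgroup G)) :=
  [set [set A | carrier A `&` K = set0] | K in @compact G] `|`
  [set [set A | carrier A `&` U !=set0] | U in @open G].

HB.instance Definition _ :=
  @isSubBaseTopological.Build (closedSubgroup G)
    (set (closedSubgroup G)) chabauty_subbase id.

Definition closed_cyclic_subgroup : set (closedSubgroup G) :=
  [set A | cyclic_subgroup (carrier A)].

End Chabauty.

(* Main.v *)
Require Import Defs.
From mathcomp Require Import all_boot all_classical topology.
From mathcomp Require Import finmap.

(** A subgroup [A] of [G] is generated by a finite set [S], and since points
    are open, the subgroups containing [S], hence [A], form a neighbourhood of
    [A]. If [A] is a limit of cyclic subgroups, it is therefore contained in a
    cyclic subgroup, so it is cyclic. *)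

Set Implicit Arguments.
Unset Strict Implicit.
Unset Printing Implicit Defensive.

Local Open Scope classical_set_scope.

Section Subgroups.
Local Open Scope group_scope.
Variable G : groupType.
Implicit Types (A S : set G) (g x y : G).

Lemma subgroupP A :
  subgroup A <-> A 1 /\ (forall x y, A x -> A y -> A (x / y)).
Proof.
split=> -[A1 AB]; split; [exact: set_mem| |exact: mem_set|].
- by move=> x y Ax Ay; apply: set_mem; apply: AB; exact: mem_set.
- by move=> x y /set_mem Ax /set_mem Ay; apply: mem_set; apply: AB.
Qed.

Lemma subgroupV A x : subgroup A -> A x -> A x^-1.
Proof. by move=> /subgroupP[A1 AB] Ax; rewrite -div1g; exact: AB. Qed.

Lemma subgroupM A x y : subgroup A -> A x -> A y -> A (x * y).
Proof.
move=> sA Ax /(subgroupV sA) Ay; rewrite -[y]invgK.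
by case/subgroupP: sA => _; exact.
Qed.

Lemma subgroupX A x n : subgroup A -> A x -> A (x ^+ n).
Proof.
move=> sA Ax; elim: n => [|n IHn]; first by case/subgroupP: sA.
by rewrite expgS; exact: subgroupM.
Qed.

Lemma subgroup_generated S : subgroup (generated S).
Proof.
apply/subgroupP; split=> [A [/subgroupP[]]//|x y Sx Sy A [sA SA]].
by case/subgroupP: (sA) => _; apply; [exact: Sx|exact: Sy].
Qed.

(** Integer powers are expressed through natural exponents, the sign being carried by the choice
    between [x] and [x^-1]. *)
Lemma generated1_pow g x :
  generated [set g] x -> exists n, x = g ^+ n \/ x^-1 = g ^+ n.
Proof.
(* Quotients of natural powers absorb both signs, so [P] is visibly closed under division: it only
   takes swapping [g ^- n] with [g ^+ l], which commute. *)
pose P := [set x | exists m n, x = g ^+ m / g ^+ n].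
have sP : subgroup P.
  apply/subgroupP; split=> [|_ _ [m [n ->]] [k [l ->]]].
    by exists 0, 0; rewrite divg1.
  exists (m + l), (k + n); rewrite !expgnDr invgF invgM !mulgA.
  congr (_ * _); rewrite -!mulgA; congr (_ * _).
  apply: commute_sym; apply: commuteV; exact: commuteX2.
have gP : [set g] `<=` P by move=> _ ->; exists 1%N, 0; rewrite divg1.
move=> /(smallest_sub sP gP)[m [n ->]].
have [le_nm|/ltnW le_mn] := leqP n m.
  by exists (m - n); left; rewrite expgnFr.
by exists (n - m); right; rewrite expgnFr// invgF.
Qed.

(** The least [d > 0] with [g ^+ d] in [A] yields a generator, by division with remainder; if there
    is no such [d], then [A] is trivial. *)
Lemma sub_cyclic_subgroup A g :
  subgroup A -> A `<=` generated [set g] -> cyclic_subgroup A.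
Proof.
move=> sA Ag.
(* Testing natural powers of [g] suffices: any other element of [A] has an inverse, again in [A],
   that is such a power. *)
have pow_gen h : A h -> (forall n, A (g ^+ n) -> exists q, g ^+ n = h ^+ q) ->
    cyclic_subgroup A.
  move=> Ah hA; exists h; apply/seteqP; split; last first.
    by apply: smallest_sub => // _ ->.
  have sh := @subgroup_generated [set h].
  have hq q : generated [set h] (h ^+ q).
    by apply: (subgroupX q sh); exact: sub_gen_smallest.
  move=> x Ax; have [n [xE|xE]] := generated1_pow (Ag _ Ax).
    by move: Ax; rewrite xE => /hA[q ->].
  rewrite -[x]invgK; apply: (subgroupV sh).
  by move: (subgroupV sA Ax); rewrite xE => /hA[q ->].
have [ex|nex] := pselect (exists d, (0 < d)%N && `[< A (g ^+ d) >]).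
  case: (ex_minnP ex) => d /andP[d0 /asboolP Ad] dmin.
  apply: (pow_gen _ Ad) => n An; exists (n %/ d)%N.
  suff nd0 : (n %% d)%N = 0.
    by rewrite {1}(divn_eq n d) nd0 addn0 mulnC expgnA.
  apply/eqP; rewrite -leqn0 leqNgt; apply/negP => nd_gt0.
  (* A positive remainder [n %% d] would be an exponent with its power in [A], smaller than the
     minimal [d]. *)
  have : (d <= n %% d)%N.
    apply: dmin; rewrite nd_gt0; apply/asboolP.
    have -> : g ^+ (n %% d)%N = (g ^+ d ^+ (n %/ d)%N)^-1 * g ^+ n.
      by rewrite {3}(divn_eq n d) expgnDr mulnC expgnA mulKg.
    by apply: subgroupM => //; apply: subgroupV => //; exact: subgroupX.
  by rewrite leqNgt ltn_mod d0.
have A1 : A 1 by case/subgroupP: sA.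
(* Only the exponent 0 can occur here, so the generator is [1]. *)
apply: (pow_gen _ A1) => -[|n] An; exists 0 => //.
by case: nex; exists n.+1; apply/asboolP.
Qed.

End Subgroups.

Lemma open_chabauty_subbase (G : topologicalGroupType)
    (U : set (closedSubgroup G)) :
  chabauty_subbase U -> open U.
Proof.
move=> bU; exists [set U]; last by rewrite bigcup_set1.
move=> _ ->; exists [fset U]%fset; first by move=> V /fset1P ->; exact/mem_set.
by apply/seteqP; split=> [B|B UB V /fset1P -> //]; apply; exact/fset1P.
Qed.

(** Containing [x] means meeting the open set [[set x]], a sub-basic condition; finiteness of [S]
    allows intersecting these neighbourhoods one point at a time. *)
Lemma nbhs_finite_subset (G : discreteGroupType) (A : closedSubgroup G)
    (S : set G) :
  finite_set S -> S `<=` carrier A -> nbhs A [set B | S `<=` carrier B].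
Proof.
move=> /finite_seqP[s ->]; elim: s => [|x s IHs] sA.
  by apply: filterS filterT => B _ y.
have Ax : nbhs A [set B | carrier B x].
  have bx : chabauty_subbase [set B : closedSubgroup G |
      carrier B `&` [set x] !=set0].
    by right; exists [set x] => //; exact: discrete_open.
  have Bx : [set B : closedSubgroup G | carrier B `&` [set x] !=set0] `<=`
      [set B | carrier B x] by move=> B [y [/= By <-]].
  apply: filterS Bx _; apply: open_nbhs_nbhs; split.
    exact: open_chabauty_subbase.
  by exists x; split=> //; apply: sA; exact: mem_head.
have As : nbhs A [set B | [set` s] `<=` carrier B].
  by apply: IHs => y ys; apply: sA; rewrite /= in_cons ys orbT.
by apply: filterS2 Ax As => B Bx Bs y /predU1P[->|/Bs].
Qed.

Theorem lemma3p3 (G : discreteGroupType)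
    (G_fg : finitely_generated [set: G])
    (subG_fg : forall H : set G, subgroup H -> finitely_generated H) :
  closed (@closed_cyclic_subgroup G).
Proof.
move=> A Acl; have [sA _] : subgroup (carrier A) /\ closed (carrier A).
  exact: (set_mem (valP A)).
have [S finS AS] := subG_fg _ sA.
have SA : S `<=` carrier A by rewrite AS; exact: sub_gen_smallest.
(* The neighbourhood of [A] given by [S] meets the cyclic subgroups in some [B]; as [S] generates
   [A], the inclusion of [S] in [B] extends to [A]. *)
have [B [[g Bg] SB]] := Acl _ (nbhs_finite_subset finS SA).
apply: (sub_cyclic_subgroup (g := g)) => //; rewrite AS -Bg.
by apply: smallest_sub => //; rewrite Bg; exact: subgroup_generated.
Qed.
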